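(* Let $\mathbb{K}\subseteq\mathbb{C}$ be a subfield (of characteristic $0$), let $f\in\mathbb{K}[x,y]$ be a nonconstant polynomial, and let $D$ be the greatest common divisor of $f_x$ and $f_y$ in $\mathbb{K}[x,y]$. Suppose there exists $\mathcal{X}_*\in V_f$ such that the $\mathbb{K}[x,y]$-module $V_f$ is freely generated by the polynomial vector fields $\mathcal{X}_0/D=-\frac{f_y}{D}\frac{\partial}{\partial x}+\frac{f_x}{D}\frac{\partial}{\partial y}$ and $\mathcal{X}_*$. Then $f$ belongs to the ideal $\langle f_x/D,\,f_y/D\rangle$ in $\mathbb{K}[x,y]$.
   Context: Write $f_x=\frac{\partial f}{\partial x}$, $f_y=\frac{\partial f}{\partial y}$, and $\mathcal{X}_0=-f_y\frac{\partial}{\partial x}+f_x\frac{\partial}{\partial y}$. $V_f$ denotes the $\mathbb{K}[x,y]$-module of all polynomial vector fields $\mathcal{X}=P\frac{\partial}{\partial x}+Q\frac{\partial}{\partial y}$ with $P,Q\in\mathbb{K}[x,y]$ for which there exists $k\in\mathbb{K}[x,y]$ with $Pf_x+Qf_y=kf$, i.e. those admitting the curve $\{f=0\}$ as an invariant curve. ''Freely generated by'' means that the listed elements form a basis of the module. *)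

(* Defs.v *)
From HB Require Import structures.
From mathcomp Require Import all_boot all_order all_algebra.
From mathcomp Require Import complex reals mpoly.

Set Implicit Arguments.
Unset Strict Implicit.
Unset Printing Implicit Defensive.

Import GRing.Theory.
Local Open Scope ring_scope.

Section CommutativeAlgebra.

Variable R : comNzRingType.

Definition divides (a b : R) : Prop := exists c, b = c * a.

(* Determined only up to a unit of R. *)
Definition is_gcd (d a b : R) : Prop :=
  [/\ divides d a, divides d b &
      forall c, divides c a -> divides c b -> divides c d].

Definition in_ideal n (g : n.-tuple R) (a : R) : Prop :=
  exists c : 'I_n -> R, a = \sum_i c i * tnth g i.

Definition freely_generated (M : lmodType R) (V : M -> Prop) n
    (e : n.-tuple M) : Prop :=
  [/\ forall i, V (tnth e i),
      forall v, V v -> exists c : 'I_n -> R, v = \sum_i c i *: tnth e i &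
      forall c : 'I_n -> R, \sum_i c i *: tnth e i = 0 -> forall i, c i = 0].

End CommutativeAlgebra.

Section PlaneVectorFields.

Variable K : fieldType.

(* In K[x, y] = {mpoly K[2]}, x is 'X_0 and y is 'X_1. *)
Definition ddx (f : {mpoly K[2]}) : {mpoly K[2]} := f^`M(0).
Definition ddy (f : {mpoly K[2]}) : {mpoly K[2]} := f^`M(1).

(* The row vector (P, Q) stands for P d/dx + Q d/dy, so that the module
   structure over K[x, y] is the one of 'rV[{mpoly K[2]}]_2. *)
Definition vfield (P Q : {mpoly K[2]}) : 'rV[{mpoly K[2]}]_2 :=
  \row_j (if j == 0 then P else Q).

Definition V_ (f : {mpoly K[2]}) (X : 'rV[{mpoly K[2]}]_2) : Prop :=
  exists k : {mpoly K[2]}, X 0 0 * ddx f + X 0 1 * ddy f = k * f.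

Lemma V_0 f : V_ f 0.
Proof. by exists 0; rewrite !mxE !mul0r addr0. Qed.

Lemma V_linear f (a : {mpoly K[2]}) X Y : V_ f X -> V_ f Y -> V_ f (a *: X + Y).
Proof.
move=> [k Hk] [l Hl]; exists (a * k + l); rewrite !mxE [RHS]mulrDl -Hl -mulrA.
by rewrite -Hk !mulrDl mulrDr !mulrA addrACA.
Qed.

End PlaneVectorFields.

(* Main.v *)
Require Import Defs.
From HB Require Import structures.
From mathcomp Require Import all_boot all_order all_algebra.
From mathcomp Require Import complex reals mpoly.

Import GRing.Theory.
Local Open Scope ring_scope.

(** Every multiple [f X] of a polynomial vector field lies in [V_ f], because
    [f X] applied to [f] is divisible by [f].  In particular [f d/dy] and
    [- f d/dx] lie in [V_ f], hence are combinations of the basis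
    [X0/D, X_*].  Since [X0/D = (f_x/D) d/dy + (f_y/D) (- d/dx)], combining the
    two decompositions with the weights [f_x/D] and [f_y/D] writes [f (X0/D)] in
    the basis, with first coefficient in the ideal generated by [f_x/D] and
    [f_y/D].  But this first coefficient is [f], as coordinates in a basis are
    unique. *)

(** If [e_k] is a combination of vectors [u_j] and [V] contains their multiples
    [a u_j], then the coordinate of [a e_k] along [e_k], which is [a], is the
    same combination of the coordinates of the [a u_j] along [e_k].  The [u_j]
    themselves may lie outside [V]; otherwise the coefficients [p_j] would
    generate the unit ideal. *)
Lemma freely_generated_in_ideal (R : comNzRingType) (M : lmodType R)
    (V : M -> Prop) n (e : n.-tuple M) (k : 'I_n)
    m (p : m.-tuple R) (u : m.-tuple M) (a : R) :
    freely_generated V e ->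
    tnth e k = \sum_j tnth p j *: tnth u j ->
    (forall j, V (a *: tnth u j)) ->
  in_ideal p a.
Proof.
move=> [_ spanV freeV] ekE Vau.
have /fin_all_exists[c cE] j := spanV _ (Vau j).
exists (c^~ k); apply/esym/eqP; rewrite -subr_eq0; apply/eqP.
pose d l := \sum_j c j l * tnth p j - (if l == k then a else 0).
suff /freeV/(_ k) : \sum_l d l *: tnth e l = 0 by rewrite /d eqxx.
under eq_bigr do rewrite scalerBl.
rewrite sumrB [X in _ - X](bigD1 k) //= eqxx [X in _ - (_ + X)]big1 => [|l /negPf->]; last first.
  by rewrite scale0r.
rewrite addr0 ekE scaler_sumr; apply/eqP; rewrite subr_eq0; apply/eqP.
under eq_bigr do rewrite scaler_suml.
rewrite exchange_big /=; apply: eq_bigr => j _.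
rewrite scalerA mulrC -scalerA cE scaler_sumr.
by apply: eq_bigr => l _; rewrite scalerA mulrC.
Qed.

Lemma V_scale_self (K : fieldType) (f : {mpoly K[2]}) (X : 'rV_2) :
  V_ f (f *: X).
Proof.
exists (X 0 0 * ddx f + X 0 1 * ddy f).
by rewrite !mxE -!mulrA -mulrDr mulrC.
Qed.

Theorem theorem2 (R : realType) (S : {pred R[i]}) (K : subFieldType S)
    (f : {mpoly K[2]}) (f_nonconst : ~ exists c : K, f = c%:MP)
    (D : {mpoly K[2]}) (D_gcd : is_gcd D (ddx f) (ddy f))
    (fxD : {mpoly K[2]}) (fxDE : ddx f = fxD * D)
    (fyD : {mpoly K[2]}) (fyDE : ddy f = fyD * D) :
  (exists2 Xs : 'rV[{mpoly K[2]}]_2,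
     V_ f Xs & freely_generated (V_ f) [tuple vfield (- fyD) fxD; Xs]) ->
  in_ideal [tuple fxD; fyD] f.
Proof.
move=> [Xs _ basisV].
(* Pairing d/dy with f_x/D and - d/dx with f_y/D gives X0/D with both
   coefficients unsigned. *)
pose u := [tuple vfield 0 1; vfield (-1) 0] : 2.-tuple 'rV[{mpoly K[2]}]_2.
apply: (freely_generated_in_ideal _ _ _ _ _ ord0 _ _ u _ basisV); last first.
  by move=> j; apply: V_scale_self.
rewrite !big_ord_recl big_ord0 addr0 !(tnth_nth 0) /=.
apply/rowP => j; rewrite !mxE.
by case: ifP => _; rewrite ?mulr0 ?mulr1 ?mulrN1 ?add0r ?addr0.
Qed.
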